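(* Let $a>0$, and let $e=1,\dots,E$ be training environments with mismatch probabilities $\delta_e\in[0,1]$ and positive weights $w_e$ summing to one. Define $$\Gamma_a(\delta):=\frac12\log\left(1+\frac{a^2}{1+a}\,\delta(1-\delta)\right).$$ Then for every environment $e$, $J_e(f_S)=J_\star(a)-\Gamma_a(\delta_e)$ and $\mathcal{L}_e(g_0\circ f_S)=\delta_e$. If $\bar\delta:=\sum_e w_e\delta_e<1/2$, then $g_0$ is the unique source-optimal decision rule for $f_S$ on the two output codes $\mathbf{b}_0,\mathbf{b}_1$ (that is, $g_0$ is source-optimal on $f_S$, and every source-optimal classifier on $f_S$ agrees with $g_0$ on $\{\mathbf{b}_0,\mathbf{b}_1\}$). In contrast, $\mathcal{L}_e(g_0\circ f_C)=0$ for every $e$.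
   Context: Environment model. For $\delta\in[0,1]$, $P_\delta$ is the law of $(\mathbf{X},Y)$ with $Y\sim\mathrm{Bernoulli}(1/2)$, $\mathbf{X}=(C,S)\in\{0,1\}^2$, $C=Y$, $S=Y\oplus B$ (exclusive-or), $B\sim\mathrm{Bernoulli}(\delta)$ independent of $Y$. The number $\delta$ is the mismatch probability. Environment $e$ has law $P_e=P_{\delta_e}$. Encoders and classifier. With $\mathbf{b}_0=(1,0)^\top$, $\mathbf{b}_1=(0,1)^\top$, set $f_C(c,s)=\mathbf{b}_c$, $f_S(c,s)=\mathbf{b}_s$ for $(c,s)\in\{0,1\}^2$, and $g_0(\mathbf{z})=\mathbf{1}\{z_2>z_1\}$. Coding objective. For $f:\{0,1\}^2\to\mathbb{S}^1\subset\mathbb{R}^2$ ($\mathbb{S}^1$ the unit circle) and environment $e$, let $\mathbf{M}_{e,y}(f)=\mathbb{E}_e[f(\mathbf{X})f(\mathbf{X})^\top\mid Y=y]$ and $\mathbf{M}_e(f)=\tfrac12(\mathbf{M}_{e,0}(f)+\mathbf{M}_{e,1}(f))$. Then $$J_e(f)=\tfrac12\log\det(\mathbf{I}_2+a\mathbf{M}_e(f))-\tfrac14\sum_{y\in\{0,1\}}\log\det(\mathbf{I}_2+a\mathbf{M}_{e,y}(f)).$$ Also $J_\star(a)=\log(1+a/2)-\tfrac12\log(1+a)$. Risk. For a classifier $g:\mathbb{S}^1\to\{0,1\}$, $\mathcal{L}_e(g\circ f)=P_e(g(f(\mathbf{X}))\ne Y)$. A classifier $g$ is source-optimal on $f$ if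 it minimises $\sum_{e}w_e\mathcal{L}_e(g\circ f)$ over all classifiers. *)

(* Defs.v *)
From HB Require Import structures.
From mathcomp Require Import all_boot all_order all_algebra.
From mathcomp Require Import all_classical all_reals all_analysis.

Set Implicit Arguments.
Unset Strict Implicit.
Unset Printing Implicit Defensive.

Import Order.TTheory GRing.Theory Num.Theory.
Import numFieldNormedType.Exports.

Local Open Scope classical_set_scope.
Local Open Scope ring_scope.

(* The covariate space {0,1}^2; an element is the pair (c, s). *)
Notation covariate := (bool * bool)%type.

(* The map (Y, B) |-> (X, Y) with X = (C, S) = (Y, Y (+) B). *)
Definition observation (yb : bool * bool) : covariate * bool :=
  ((yb.1, yb.1 (+) yb.2), yb.1).

Lemma measurable_observation : measurable_fun setT observation.
Proof.
have mb (A : set (bool * bool)) : measurable A.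
  rewrite (_ : A = \bigcup_(p in A) ([set p.1] `*` [set p.2])); last first.
    by apply/seteqP; split=> [p Ap|[u v] [[a b] Aab [/= -> ->]]//]; exists p.
  by apply: fin_bigcup_measurable => [|p _]; [exact: finite_finset|exact: measurableX].
by do 2 apply: measurable_fun_pair => //; move=> _ B _; rewrite setTI; exact: mb.
Qed.

HB.instance Definition _ := @isMeasurableFun.Build _ _ _ _ observation
  measurable_observation.

Section objects.
Context {R : realType}.

(* Law of (X, Y); independence of Y and B is encoded by the product measure. *)
Definition law (delta : R) : probability (covariate * bool)%type R :=
  distribution (bernoulli_prob (2^-1)%R \x bernoulli_prob delta)%E observation.

Definition circle := {z : 'cV[R]_2 | z 0 0 ^+ 2 + z 1 0 ^+ 2 == 1}.

Lemma basis_code_subproof (c : bool) :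
  let z : 'cV[R]_2 := delta_mx (if c then 1 else 0) 0 in
  z 0 0 ^+ 2 + z 1 0 ^+ 2 == 1.
Proof. by case: c; rewrite /= !mxE /= expr0n expr1n ?add0r ?addr0. Qed.

(* b_0 = (1,0)^T and b_1 = (0,1)^T *)
Definition basis_code (c : bool) : circle :=
  exist _ (delta_mx (if c then 1 else 0) 0) (basis_code_subproof c).

Definition f_C (x : covariate) : circle := basis_code x.1.
Definition f_S (x : covariate) : circle := basis_code x.2.

(* The coordinates z_1, z_2 are the entries of index 0 and 1. *)
Definition g_0 (z : circle) : bool := val z 0 0 < val z 1 0.

Implicit Types (P : probability (covariate * bool)%type R).

(* E[Z | Y = y], for P(Y = y) > 0 *)
Definition cond_expectation P (y : bool) (Z : covariate -> R) : R :=
  let A := [set w : covariate * bool | w.2 = y] in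
  fine ('E_P[fun w => (Z w.1 * \1_A w)%R])%E / fine (P A).

Definition class_moment P (f : covariate -> circle) (y : bool) : 'M[R]_2 :=
  \matrix_(i, j) cond_expectation P y
    (fun x => (val (f x) *m (val (f x))^T) i j).

Definition moment P (f : covariate -> circle) : 'M[R]_2 :=
  2^-1 *: (class_moment P f false + class_moment P f true).

Definition coding_objective (a : R) P (f : covariate -> circle) : R :=
  2^-1 * ln (\det (1%:M + a *: moment P f))
  - 4^-1 * \sum_(y : bool) ln (\det (1%:M + a *: class_moment P f y)).

Definition J_star (a : R) : R := ln (1 + a / 2) - 2^-1 * ln (1 + a).

Definition Gamma (a delta : R) : R :=
  2^-1 * ln (1 + a ^+ 2 / (1 + a) * (delta * (1 - delta))).

Definition risk P (h : covariate -> bool) : R :=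
  fine (P [set w | h w.1 != w.2]).

Definition source_risk (E : nat) (w delta : 'I_E -> R)
    (h : covariate -> bool) : R :=
  \sum_(e < E) w e * risk (law (delta e)) h.

(* No measurability is required of classifiers: each error event is a subset of
   the finite space of pairs (X, Y), hence measurable. *)
Definition source_optimal (E : nat) (w delta : 'I_E -> R)
    (f : covariate -> circle) (g : circle -> bool) : Prop :=
  forall g' : circle -> bool,
    source_risk w delta (g \o f) <= source_risk w delta (g' \o f).

End objects.

Arguments circle R : clear implicits.
Arguments f_C R : clear implicits.
Arguments f_S R : clear implicits.
Arguments g_0 R z : clear implicits.

(* Main.v *)
(* Given Y, the shortcut S is Y with probability 1 - delta and ~~ Y otherwise, so
   the class moments of f_S are diag(1 - delta, delta) up to order and their
   average is I/2; the two class determinants coincide and factor as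
   (1 + a) (1 + a^2 / (1 + a) * delta (1 - delta)), which gives J_star - Gamma.
   Each code on which a rule disagrees with g_0 raises the source risk by
   1/2 minus the average mismatch, hence optimality and uniqueness. *)
Require Import Defs.
From mathcomp Require Import all_boot all_order all_algebra.
From mathcomp Require Import all_classical all_reals all_analysis.
From mathcomp Require Import ring lra.

Set Implicit Arguments.
Unset Strict Implicit.
Unset Printing Implicit Defensive.

Import Order.TTheory GRing.Theory Num.Theory.

Local Open Scope ring_scope.

(** Each set is a finite union of singleton rectangles, so discreteness passes to products and all
    measurability conditions on the sample spaces become automatic. *)
Lemma measurable_finite_prod d1 d2
    (T1 : measurableType d1) (T2 : measurableType d2) :
  (forall A : set T1, measurable A) -> (forall A : set T2, measurable A) ->
  finite_set [set: T1] -> finite_set [set: T2] ->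
  forall A : set (T1 * T2), measurable A.
Proof.
move=> m1 m2 fin1 fin2 A.
rewrite (_ : A = \bigcup_(p in A) ([set p.1] `*` [set p.2]))%classic; last first.
  by apply/seteqP; split=> [p Ap|[u v] [[x y] Axy [/= -> ->]]//]; exists p.
apply: fin_bigcup_measurable => [|p _]; last exact: measurableX.
apply: (sub_finite_set (@subsetT _ A)).
by rewrite -setXTT; exact: finite_setX.
Qed.

Lemma measurable_covariate_label (A : set (covariate * bool)) : measurable A.
Proof.
by do 2! [apply: measurable_finite_prod => //; try exact: finite_finset].
Qed.

Section law.
Variables (R : realType) (delta : R).
Hypothesis delta01 : 0 <= delta <= 1.

(** Pushforward, then Tonelli: the outer Bernoulli integral runs over [Y], the inner one over the
    flip [B], whose value [true] puts [~~ y] in the shortcut coordinate. *)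
Lemma ge0_integral_law (F : covariate * bool -> R) : (forall w, 0 <= F w) ->
  (\int[law delta]_w (F w)%:E)%E =
  (\sum_(y : bool) 2^-1 * ((1 - delta) * F ((y, y), y)
                           + delta * F ((y, ~~ y), y)))%:E.
Proof.
move=> F0.
have half01 : 0 <= (2^-1 : R) <= 1 by lra.
rewrite ge0_integral_distribution//=; last first.
  by move=> _ Y _; exact: measurable_covariate_label.
rewrite fubini_tonelli1//=; first last.
- by move=> p; rewrite lee_fin.
- by move=> _ Y _; apply: measurable_finite_prod => //; exact: finite_finset.
rewrite /fubini_F.
under eq_integral => x _.
  rewrite (integral_bernoulli_prob delta01); last by move=> b; rewrite lee_fin.
  over.
rewrite (integral_bernoulli_prob half01)/= => [|x].
  rewrite -!EFinM -!EFinD big_bool/=; congr (_%:E).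
  by rewrite /unstable.onem; lra.
rewrite -!EFinM -EFinD lee_fin.
by case/andP: delta01 => ? ?; rewrite addr_ge0// mulr_ge0// subr_ge0.
Qed.

Lemma fine_lawE (A : set (covariate * bool)) :
  fine (law delta A) =
  \sum_(y : bool) 2^-1 * ((1 - delta) * \1_A ((y, y), y)
                          + delta * \1_A ((y, ~~ y), y)).
Proof.
rewrite -[A in LHS]setIT -integral_indic//; last exact: measurable_covariate_label.
by rewrite ge0_integral_law//.
Qed.

Lemma cond_expectation_lawE (y : bool) (Z : covariate -> R) :
  (forall x, 0 <= Z x) ->
  cond_expectation (law delta) y Z =
  (1 - delta) * Z (y, y) + delta * Z (y, ~~ y).
Proof.
move=> Z0; rewrite /cond_expectation fine_lawE unlock ge0_integral_law/=.
  rewrite !big_bool !indicE.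
  have inA s b : ((b, s, b) \in [set w : covariate * bool | w.2 = y]%classic)
      = (b == y) by apply/idP/eqP; rewrite inE.
  (* The indicator keeps only the atoms of label [y]; their weight 1/2 cancels against P(Y = y) =
     1/2, whose non-vanishing is left by [field]. *)
  rewrite !inA; case: y {inA} => /=; field; apply: lt0r_neq0; lra.
by move=> w; rewrite mulr_ge0.
Qed.

Lemma risk_lawE (h : covariate -> bool) :
  risk (law delta) h =
  \sum_(y : bool) 2^-1 * ((1 - delta) * (h (y, y) != y)%:R
                          + delta * (h (y, ~~ y) != y)%:R).
Proof.
rewrite /risk fine_lawE; apply: eq_bigr => y _; rewrite !indicE.
by congr (_ * (_ * _%:R + _ * _%:R)); apply: congr1; apply/idP/idP; rewrite inE.
Qed.

Lemma class_moment_f_S (y : bool) :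
  class_moment (law delta) (f_S R) y =
  (1 - delta) *: delta_mx (if y then 1 else 0) (if y then 1 else 0)
  + delta *: delta_mx (if y then 0 else 1) (if y then 0 else 1).
Proof.
apply/matrixP => i j; rewrite !mxE cond_expectation_lawE.
  by rewrite /f_S /= !trmx_delta !mul_delta_mx !mxE; case: y.
by move=> x; rewrite /= trmx_delta mul_delta_mx mxE ler0n.
Qed.

Lemma det_class_moment_f_S (a : R) (y : bool) :
  \det (1%:M + a *: class_moment (law delta) (f_S R) y) =
  1 + a + a ^+ 2 * (delta * (1 - delta)).
Proof.
(* The matrix is diagonal, hence triangular: its determinant is (1 + a(1 - delta))(1 + a delta), in
   an order depending on [y]. *)
rewrite det_trig.
  by rewrite class_moment_f_S !big_ord_recl big_ord0 !mxE; case: y => /=; ring.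
apply/is_trig_mxP => i j; rewrite class_moment_f_S !mxE.
by case: y; move: i j => [[|[|//]] ?] [[|[|//]] ?]//= _;
  rewrite !(mulr0, addr0).
Qed.

Lemma moment_f_S : moment (law delta) (f_S R) = 2^-1%:M.
Proof.
apply/matrixP => i j; rewrite /moment !class_moment_f_S !mxE.
by case: i j => [[|[|//]] ?] [[|[|//]] ?]/=; lra.
Qed.

Lemma coding_objective_f_S (a : R) : 0 < a ->
  coding_objective a (law delta) (f_S R) = J_star a - Gamma a delta.
Proof.
move=> a0; rewrite /coding_objective moment_f_S.
(* The determinant is (1 + a/2)^2; [lnXn] extracts the exponent 2, which cancels the prefactor
   1/2. *)
rewrite scale_scalar_mx -raddfD det_scalar lnXn; last by lra.
rewrite !big_bool/= !det_class_moment_f_S /J_star /Gamma.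
have d0 : 0 <= delta * (1 - delta).
  by case/andP: delta01 => ? ?; rewrite mulr_ge0 ?subr_ge0.
have -> : 1 + a + a ^+ 2 * (delta * (1 - delta)) =
  (1 + a) * (1 + a ^+ 2 / (1 + a) * (delta * (1 - delta))) by field; apply: lt0r_neq0; lra.
rewrite lnM ?posrE//; [|lra|].
  by field.
by rewrite ltr_wpDr// mulr_ge0// divr_ge0 ?sqr_ge0//; lra.
Qed.

End law.

Lemma g_0_basis_code (R : realType) (c : bool) : g_0 R (basis_code c) = c.
Proof. by case: c; rewrite /g_0 /= !mxE/= ?ltr01 ?ltr10. Qed.

(** The code of [c] has joint mass (1 - delta)/2 with label [c] and delta/2 with [~~ c], so a wrong
    decision there costs the difference 1/2 - delta. *)
Lemma risk_f_S (R : realType) (delta : R) (g : circle R -> bool) :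
  0 <= delta <= 1 ->
  risk (law delta) (g \o f_S R) =
  delta + (2^-1 - delta) *
    ((g (basis_code false) != false)%:R + (g (basis_code true) != true)%:R).
Proof.
move=> d01; rewrite risk_lawE// big_bool /f_S/=.
by case: (g _) => /=; case: (g _) => /=; lra.
Qed.

(** For a fixed rule the risk is affine in the mismatch, so averaging with weights of sum one just
    replaces it by its mean. *)
Lemma source_risk_f_S (R : realType) (E : nat) (w delta : 'I_E -> R)
    (g : circle R -> bool) :
  (forall e, 0 <= delta e <= 1) -> \sum_(e < E) w e = 1 ->
  source_risk w delta (g \o f_S R) =
  \sum_(e < E) w e * delta e + (2^-1 - \sum_(e < E) w e * delta e) *
    ((g (basis_code false) != false)%:R + (g (basis_code true) != true)%:R).
Proof.
move=> d01 w1; rewrite /source_risk.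
under eq_bigr => e _ do rewrite (risk_f_S _ (d01 e)) mulrDr mulrA mulrBr.
by rewrite big_split/= -mulr_suml sumrB -mulr_suml w1 mul1r.
Qed.

Theorem proposition3p2 (R : realType) (a : R) (E : nat) (delta w : 'I_E -> R)
    (a_gt0 : 0 < a)
    (delta01 : forall e, 0 <= delta e <= 1)
    (w_gt0 : forall e, 0 < w e)
    (w_sum1 : \sum_(e < E) w e = 1) :
  [/\ forall e, coding_objective a (law (delta e)) (f_S R)
                = J_star a - Gamma a (delta e)
             /\ risk (law (delta e)) (g_0 R \o f_S R) = delta e,
      \sum_(e < E) w e * delta e < 2^-1 ->
        source_optimal w delta (f_S R) (g_0 R)
        /\ (forall g : circle R -> bool, source_optimal w delta (f_S R) g ->
              forall c : bool, g (basis_code c) = g_0 R (basis_code c))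
    & forall e, risk (law (delta e)) (g_0 R \o f_C R) = 0].
Proof.
split=> [e|dbar_lt|e].
- by rewrite coding_objective_f_S// risk_f_S// !g_0_basis_code addr0 mulr0 addr0.
- split=> [g'|g /(_ (g_0 R))].
    rewrite !source_risk_f_S//= !g_0_basis_code addr0 mulr0 addr0 lerDl.
    by apply: mulr_ge0; rewrite ?ler0n// ?subr_ge0 ?ltW// addr_ge0.
  rewrite !source_risk_f_S//= !g_0_basis_code addr0 mulr0 addr0 gerDl.
  (* The positive factor 1/2 minus the mean forces the number of disagreements to be at most 0, so
     both indicators vanish. *)
  rewrite pmulr_rle0 ?subr_gt0// -natrD lern0 addn_eq0 !eqb0 !negbK.
  by move=> /andP[/eqP gF /eqP gT] [|]; rewrite g_0_basis_code.
- rewrite risk_lawE// big_bool /f_C/= !g_0_basis_code.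
  by rewrite !eqxx /= !(mulr0, addr0).
Qed.
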